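(* For a time query $(A,B,t_0)$, the time query algorithm in the station graph model described below solves the earliest arrival problem: it returns the minimum of $arr(P)$ over all consistent connections $P$ from $A$ to $B$ with $dep(P)\ge t_0$ (and $\perp$ if no such connection exists). Algorithm: set $ac(S):=\emptyset$ for all stations $S\ne A$ and $ac(A):=\{(t_0,\forall)\}$; insert $A$ into a priority queue with key $t_0$. While the queue is nonempty: delete the station $S$ with minimum key $t$; if $S=B$ return $t$; for each edge $e=(S,T)$, let $N:=\mathrm{minimum}\{ac(T),\, e.\mathrm{link}(ac(S))\}$; if $N\ne ac(T)$, set $ac(T):=N$, let $k:=\min_{P\in N} arr(P)$, and insert $T$ with key $k$ (or decrease its key to $k$ if $T$ is already in the queue). If the queue becomes empty, return $\perp$.
   Context: A timetable consists of a set $\mathcal{B}$ of stations, for each station $S$ a set of stop events, a minimum transfer time $\mathit{transfer}(S)\ge0$, and a set of elementary connections $c=(Z_1,Z_2,S_1,S_2,t_d,t_a)$: a train leaves $S_1$ at time $t_d$ after stop event $Z_1$, and its immediately next stop is stop event $Z_2$ at $S_2$ at time $t_a$ ($t_d,t_a\in\{0,\dots,1439\}$); consecutive elementary connections of a train share a stop event; $\mathit{length}(c)$ is the smallest nonnegative $\ell\equiv t_a-t_d\pmod{1440}$; trains operate on given days (generally daily). A connection $P=(c_1,\dots,c_k)$ with absolute times $dep_i(P),arr_i(P)$ is consistent if for all $i$: $c_i$ operates on day $\lfloor dep_i(P)/1440\rfloor$; $S_2(c_i)=S_1(c_{i+1})$; $dep_i(P)\equiv t_d(c_i)\pmod{1440}$;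 $arr_i(P)=dep_i(P)+\mathit{length}(c_i)$; and $dep_{i+1}(P)-arr_i(P)\ge0$ if $Z_1(c_{i+1})=Z_2(c_i)$, $\ge\mathit{transfer}(S_2(c_i))$ otherwise. $dep(P)=dep_1(P)$, $arr(P)=arr_k(P)$, $Z_2(P)=Z_2(c_k)$, $S_2(P)=S_2(c_k)$. Station graph: one node per station, and a (single) edge $e=(S,T)$ for each ordered pair of stations joined by at least one elementary connection; the edge carries the set of elementary connections from $S$ to $T$. For the query $(A,B,t_0)$, an arrival connection at station $S$ is a pair $(arr,Z)$ representing a connection from $A$ arriving at $S$ at time $arr$ with stop event $Z$; it is consistent if it is a consistent connection $Q$ from $A$ with $dep_1(Q)\ge t_0$. The special pair $(t_0,\forall)$ at $A$ represents being at $A$ at time $t_0$ and able to board any train departing at $t_0$ or later (no transfer time applies). For an arrival connection $Q$ at $S$, $ndep(Q)$ is the next departure time of stop event $Z_2(Q)$ at $S$, or $\perp$ if the train ends there; $Q$ has a critical arrival if $ndep(Q)\ne\perp$ and $ndep(Q)-arr(Q)<\mathit{transfer}(S)$. Arrival connection $P$ dominates $Q$ iff $S_2(P)=S_2(Q)$, $arr(P)\le arr(Q)$, and ($Z_2(Q)=Z_2(P)$, or $Q$ has no critical arrival, or $ndep(Q)-arr(P)\ge\mathit{transfer}(S_2(P))$). Operations: $e.\mathrm{link}(X)$, for an edge $e=(S,T)$ and a set $X$ of consistent arrival connections at $S$, returns a set of consistent arrival connections at $T$, each obtained by extending an element of $X$ by one elementary connection of $e$ (consistently), such that every consistent arrival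 connection obtainable in this way is dominated by some returned element. $\mathrm{minimum}\{Y,Z\}$ returns a subset of $Y\cup Z$ such that every element of $Y\cup Z$ is dominated by some element of the returned set.
   Formalization: Termination is proved only if minimum{Y,Z} returns Y whenever Y is an initial or computed set dominating all of Z (with Y∪Z as minimum the loop can run forever); returned answers are correct without this; for A = B the empty journey arriving at t0 counts. *)

(* Defs.v *)
From HB Require Import structures.
From mathcomp Require Import all_boot finmap.

Set Implicit Arguments.
Unset Strict Implicit.
Unset Printing Implicit Defensive.

(* Elementary connections (Z1, Z2, S1, S2, td, ta).  Times are in minutes. *)
Definition elconn (station stop : Type) : Type :=
  (stop * stop * station * station * 'I_1440 * 'I_1440)%type.

Definition Z1 station stop (c : elconn station stop) : stop :=
  let: (z, _, _, _, _, _) := c in z.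
Definition Z2 station stop (c : elconn station stop) : stop :=
  let: (_, z, _, _, _, _) := c in z.
Definition S1 station stop (c : elconn station stop) : station :=
  let: (_, _, s, _, _, _) := c in s.
Definition S2 station stop (c : elconn station stop) : station :=
  let: (_, _, _, s, _, _) := c in s.
Definition td station stop (c : elconn station stop) : nat :=
  let: (_, _, _, _, t, _) := c in t.
Definition ta station stop (c : elconn station stop) : nat :=
  let: (_, _, _, _, _, t) := c in t.

(* The least l >= 0 with l = ta - td modulo 1440; 1440 is added first because
   subtraction on nat truncates. *)
Definition elength station stop (c : elconn station stop) : nat :=
  (ta c + 1440 - td c) %% 1440.

(* [operates c n] : the elementary connection c runs on day n.  A train running
   daily is the case [operates c n = true] for all n. *)
Record timetable := Timetable {
  station : finType;
  stop : finType;
  stops : station -> {set stop};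
  transfer : station -> nat;
  conns : {set elconn station stop};
  operates : elconn station stop -> nat -> bool;
  conns_stops : forall c, c \in conns ->
    Z1 c \in stops (S1 c) /\ Z2 c \in stops (S2 c)
}.

Definition conn (tt : timetable) : finType := elconn (station tt) (stop tt).

(* c runs, leaving S1 c at the absolute time d (which includes the day). *)
Definition departs (tt : timetable) (c : conn tt) (d : nat) : bool :=
  [&& c \in conns tt, operates c (d %/ 1440) & d == td c %[mod 1440]].

(* (c_i, dep_i, arr_i) *)
Definition leg (tt : timetable) : Type := (conn tt * nat * nat)%type.

Definition leg_conn (tt : timetable) (l : leg tt) : conn tt := l.1.1.
Definition leg_dep (tt : timetable) (l : leg tt) : nat := l.1.2.
Definition leg_arr (tt : timetable) (l : leg tt) : nat := l.2.

Definition leg_ok (tt : timetable) (l : leg tt) : bool :=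
  departs (leg_conn l) (leg_dep l) &&
  (leg_arr l == leg_dep l + elength (leg_conn l)).

Definition change_ok (tt : timetable) (l l' : leg tt) : bool :=
  (S2 (leg_conn l) == S1 (leg_conn l')) &&
  (if Z1 (leg_conn l') == Z2 (leg_conn l) then leg_arr l <= leg_dep l'
   else leg_arr l + transfer (S2 (leg_conn l)) <= leg_dep l').

(* A nonempty sequence of legs: the first one and the list of the others. *)
Definition connection (tt : timetable) : Type := (leg tt * seq (leg tt))%type.

Definition last_leg (tt : timetable) (P : connection tt) : leg tt :=
  last P.1 P.2.

Definition consistent (tt : timetable) (P : connection tt) : bool :=
  all (@leg_ok tt) (P.1 :: P.2) && path (@change_ok tt) P.1 P.2.

Definition dep_of (tt : timetable) (P : connection tt) : nat := leg_dep P.1.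
Definition arr_of (tt : timetable) (P : connection tt) : nat :=
  leg_arr (last_leg P).
Definition from_of (tt : timetable) (P : connection tt) : station tt :=
  S1 (leg_conn P.1).
Definition to_of (tt : timetable) (P : connection tt) : station tt :=
  S2 (leg_conn (last_leg P)).
Definition stop_of (tt : timetable) (P : connection tt) : stop tt :=
  Z2 (leg_conn (last_leg P)).

(* t is the arrival time at B of a journey of the query (A, B, t0).  The first
   disjunct is the journey without any leg, of which the pair (t0, forall) is
   the arrival; it only matters for the degenerate query A = B. *)
Definition journey_arrival (tt : timetable) (A B : station tt) (t0 t : nat) :
    Prop :=
  (A = B /\ t = t0) \/
  exists P : connection tt,
    [/\ consistent P, from_of P = A, to_of P = B, t0 <= dep_of P
      & arr_of P = t].

(* None stands for bottom. *)
Definition earliest_arrival (tt : timetable) (A B : station tt) (t0 : nat)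
    (r : option nat) : Prop :=
  if r is Some t then
    journey_arrival A B t0 t /\
    forall t', journey_arrival A B t0 t' -> t <= t'
  else forall t', ~ journey_arrival A B t0 t'.

(* Station graph: at most one edge per ordered pair of stations; the edge
   carries all elementary connections of the pair. *)
Definition edge (tt : timetable) (S T : station tt) : bool :=
  [exists c in conns tt, (S1 c == S) && (S2 c == T)].

(* Arrival connections (arr, Z); (arr, None) encodes (arr, forall). *)
Definition label (tt : timetable) : choiceType :=
  (nat * option (stop tt))%type.

Definition arrival_conn (tt : timetable) (A : station tt) (t0 : nat)
    (S : station tt) (q : label tt) : Prop :=
  if q.2 is Some z then
    exists P : connection tt,
      [/\ consistent P, from_of P = A & t0 <= dep_of P] /\
      [/\ to_of P = S, arr_of P = q.1 & stop_of P = z]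
  else S = A /\ q.1 = t0.

(* c continues the stop event z; the wildcard None matches every departure. *)
Definition boards (tt : timetable) (z : option (stop tt)) (c : conn tt) :
    bool :=
  if z is Some z' then Z1 c == z' else true.

(* ndep(q) = d at S; ndep(q) is bottom when there is no such d. *)
Definition is_ndep (tt : timetable) (S : station tt) (q : label tt) (d : nat) :
    Prop :=
  let leaves d := q.1 <= d /\
    exists c : conn tt, [/\ S1 c = S, boards q.2 c & departs c d] in
  leaves d /\ forall d', leaves d' -> d <= d'.

Definition critical (tt : timetable) (S : station tt) (q : label tt) : Prop :=
  exists d, is_ndep S q d /\ d - q.1 < transfer S.

(* p dominates q, both being arrival connections at S.  In the first case the
   stop event of p is that of q or the wildcard.  The truncated difference in
   the last case is exact, since p.1 <= q.1 <= d. *)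
Definition dominates (tt : timetable) (S : station tt) (p q : label tt) :
    Prop :=
  p.1 <= q.1 /\
  [\/ p.2 = None \/ p.2 = q.2,
      ~ critical S q
    | exists d, is_ndep S q d /\ transfer S <= d - p.1].

(* q is p, an arrival connection at S, followed by one elementary connection
   of the edge (S, T). *)
Definition extends (tt : timetable) (S T : station tt) (p q : label tt) :
    Prop :=
  exists (c : conn tt) (d : nat),
    [/\ S1 c = S, S2 c = T & departs c d] /\
    (if boards p.2 c then p.1 <= d else p.1 + transfer S <= d) /\
    q = (d + elength c, Some (Z2 c)).

Definition link_spec (tt : timetable) (A : station tt) (t0 : nat)
    (link : station tt * station tt -> {fset label tt} -> {fset label tt}) :
    Prop :=
  forall (S T : station tt) (X : {fset label tt}),
    edge S T -> (forall p, p \in X -> arrival_conn A t0 S p) ->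
    (forall q, q \in link (S, T) X ->
       arrival_conn A t0 T q /\ exists2 p, p \in X & extends S T p q) /\
    (forall p q, p \in X -> extends S T p q -> arrival_conn A t0 T q ->
       exists2 q', q' \in link (S, T) X & dominates T q' q).

(* The station argument of [minimum] is the one at which both sets of arrival
   connections live, on which domination depends. *)
Definition minimum_spec (tt : timetable) (A : station tt) (t0 : nat)
    (minimum : station tt -> {fset label tt} -> {fset label tt} ->
               {fset label tt}) : Prop :=
  forall (T : station tt) (Y Z : {fset label tt}),
    (forall q, q \in (Y `|` Z)%fset -> arrival_conn A t0 T q) ->
    (minimum T Y Z `<=` Y `|` Z)%fset /\
    (forall q, q \in (Y `|` Z)%fset ->
       exists2 p, p \in minimum T Y Z & dominates T p q).

Definition initial_ac (tt : timetable) (A : station tt) (t0 : nat)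
    (S : station tt) : {fset label tt} :=
  if S == A then [fset (t0, None)]%fset else fset0.

(* Domination is only a preorder, so a minimum is not unique.  This property
   says that an initial or previously computed set is kept when the incoming
   arrival connections are all dominated by it. *)
Definition minimum_stable (tt : timetable) (A : station tt) (t0 : nat)
    (minimum : station tt -> {fset label tt} -> {fset label tt} ->
               {fset label tt}) : Prop :=
  forall (T : station tt) (Y Z : {fset label tt}),
    (forall q, q \in (Y `|` Z)%fset -> arrival_conn A t0 T q) ->
    Y = initial_ac A t0 T \/
      (exists Y' Z', (forall q, q \in (Y' `|` Z')%fset ->
                        arrival_conn A t0 T q) /\ Y = minimum T Y' Z') ->
    (forall q, q \in Z -> exists2 p, p \in Y & dominates T p q) ->
    minimum T Y Z = Y.

(* [queue S = Some k] : S is in the priority queue with key k. *)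
Record state (tt : timetable) := State {
  ac : {ffun station tt -> {fset label tt}};
  queue : {ffun station tt -> option nat}
}.

Definition initial_state (tt : timetable) (A : station tt) (t0 : nat) :
    state tt :=
  State [ffun S => initial_ac A t0 S]
        [ffun S => if S == A then Some t0 else None].

(* The least arrival time in N; the value 0 for the empty set is never used. *)
Definition min_arr (tt : timetable) (N : {fset label tt}) : nat :=
  if enum_fset N is p :: s then foldr minn p.1 [seq q.1 | q <- s] else 0.

Definition relax (tt : timetable)
    (link : station tt * station tt -> {fset label tt} -> {fset label tt})
    (minimum : station tt -> {fset label tt} -> {fset label tt} ->
               {fset label tt})
    (S : station tt) (st : state tt) (T : station tt) : state tt :=
  let N := minimum T (ac st T) (link (S, T) (ac st S)) in
  if N == ac st T then st
  else State [ffun T' => if T' == T then N else ac st T']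
             [ffun T' => if T' == T then Some (min_arr N) else queue st T'].

Definition is_delete_min (tt : timetable) (st : state tt) (S : station tt)
    (t : nat) : Prop :=
  queue st S = Some t /\
  forall S' t', queue st S' = Some t' -> t <= t'.

Definition dequeue (tt : timetable) (st : state tt) (S : station tt) :
    state tt :=
  State (ac st) [ffun S' => if S' == S then None else queue st S'].

(* One iteration of the loop, for a deleted station other than B.  Neither the
   choice among stations of equal key nor the order ts in which the outgoing
   edges are visited is prescribed. *)
Definition iteration (tt : timetable)
    (link : station tt * station tt -> {fset label tt} -> {fset label tt})
    (minimum : station tt -> {fset label tt} -> {fset label tt} ->
               {fset label tt})
    (B : station tt) (st st' : state tt) : Prop :=
  exists (S : station tt) (t : nat) (ts : seq (station tt)),
    [/\ is_delete_min st S t, S <> B, perm_eq ts (enum (edge S))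
      & st' = foldl (relax link minimum S) (dequeue st S) ts].

(* Some run from st stops with the result r. *)
Inductive returns (tt : timetable)
    (link : station tt * station tt -> {fset label tt} -> {fset label tt})
    (minimum : station tt -> {fset label tt} -> {fset label tt} ->
               {fset label tt})
    (B : station tt) : state tt -> option nat -> Prop :=
| Returns_bottom st :
    (forall S, queue st S = None) ->
    returns link minimum B st None
| Returns_target st t :
    is_delete_min st B t ->
    returns link minimum B st (Some t)
| Returns_iteration st st' r :
    iteration link minimum B st st' ->
    returns link minimum B st' r ->
    returns link minimum B st r.

(* There is no infinite run from st. *)
Definition terminates (tt : timetable)
    (link : station tt * station tt -> {fset label tt} -> {fset label tt})
    (minimum : station tt -> {fset label tt} -> {fset label tt} ->
               {fset label tt})
    (B : station tt) (st : state tt) : Prop :=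
  Acc (fun st2 st1 => iteration link minimum B st1 st2) st.

(* Main.v *)
(* Domination is transitive, and every elementary connection that extends a
   dominated label also extends the dominating one.  Hence, between two
   iterations, every extension of a label of an unqueued station is dominated
   at its head.  The key of a queued station is its least arrival time, so if
   t is the least key, then each prefix of a journey arriving before t is
   dominated at an unqueued station; a target deleted with key t therefore
   cannot be reached before t.
   Termination: for each station T and stop event Z, the set of times a such
   that (a, Z) is dominated at T is an upper set of nat which never shrinks,
   and by stability one of these sets grows whenever some ac(T) changes.  The
   triple (number of empty sets, sum of the minima of the others, size of the
   queue) decreases lexicographically. *)

Require Import Defs.
From mathcomp Require Import all_boot finmap.
From Stdlib Require Import Classical.

Set Implicit Arguments.
Unset Strict Implicit.
Unset Printing Implicit Defensive.

(** Excluded middle stands in for a decision procedure, since the predicates minimised later,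
    departures of a stop event and covered times, are plain propositions. *)
Lemma ex_least (P : nat -> Prop) n :
  P n -> exists m, [/\ P m, m <= n & forall k, P k -> m <= k].
Proof.
elim/ltn_ind: n => n IH Pn.
have [[m lt_mn Pm]|noP] := classic (exists2 m, m < n & P m).
  have [k [Pk le_km kmin]] := IH m lt_mn Pm.
  by exists k; split=> //; apply: leq_trans le_km (ltnW lt_mn).
exists n; split=> // k Pk; rewrite leqNgt; apply/negP => lt_kn.
by apply: noP; exists k.
Qed.

(** * Domination as a preorder, and its compatibility with extension *)

Section Domination.

Variables (tt : timetable) (S : station tt).
Implicit Types p q r : label tt.

Lemma ndep_exists q (c : conn tt) d :
  S1 c = S -> boards q.2 c -> departs c d -> q.1 <= d ->
  exists2 e, is_ndep S q e & e <= d.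
Proof.
move=> Sc bc dc le_qd.
pose leaves e := q.1 <= e /\
  exists c : conn tt, [/\ S1 c = S, boards q.2 c & departs c e].
have /ex_least[e [Pe le_ed emin]] : leaves d by split=> //; exists c.
by exists e.
Qed.

Lemma dominates_refl q : dominates S q q.
Proof. by split=> //; apply: Or31; right. Qed.

Lemma dominates_leq p q : dominates S p q -> p.1 <= q.1.
Proof. by case. Qed.

Lemma not_critical_ndep q e :
  ~ critical S q -> is_ndep S q e -> q.1 + transfer S <= e.
Proof.
move=> ncq ne; have [[le_qe _] _] := ne.
rewrite -leq_subRL // leqNgt; apply/negP => lt_e.
by apply: ncq; exists e.
Qed.

Lemma ndep_mono q r e :
  q.2 = None \/ q.2 = r.2 -> q.1 <= r.1 -> is_ndep S r e ->
  exists2 e', is_ndep S q e' & e' <= e.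
Proof.
move=> qr le_qr [[le_re [c [Sc bc dc]]] _].
apply: (ndep_exists Sc _ dc (leq_trans le_qr le_re)).
by case: qr => ->.
Qed.

(** Only a critical [r], with next departure [e], needs work. If [q] continues the stop event of [r]
    or is the wildcard, the next departure of [q] is at most [e], so a transfer that fits before it
    also fits before [e]. If [q] leaves time for a transfer, the earlier [p] does too. *)
Lemma dominates_trans q p r :
  dominates S p q -> dominates S q r -> dominates S p r.
Proof.
move=> [le_pq pq] [le_qr qr]; split; first exact: leq_trans le_qr.
have [[e [ne lt_e]]|ncr] := classic (critical S r); last by apply: Or32.
case: qr => [qr|ncr|[f [nf le_f]]]; first last.
- by apply: Or33; exists f; split=> //; apply: leq_trans le_f (leq_sub2l _ _).
- by apply: Or32.
have [e' ne' le_e'] := ndep_mono qr le_qr ne.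
case: pq => [pq|ncq|[f [[[le_qf _] fmin] le_f]]].
- by apply: Or31; case: pq => ->; [left|].
- apply: Or33; exists e; split=> //.
  have := not_critical_ndep ncq ne'.
  have: p.1 <= e.
    by apply: leq_trans le_pq (leq_trans le_qr _); case: ne => [[]].
  move=> le_pe le_qe'; rewrite leq_subRL //.
  by apply: leq_trans le_e'; apply: leq_trans le_qe'; rewrite leq_add2r.
- apply: Or33; exists e; split=> //.
  apply: leq_trans le_f (leq_sub2r _ _); apply: leq_trans le_e'.
  by apply: fmin; case: ne'.
Qed.

(** If [q] needs a transfer to reach [c], the earlier [p] has time for it as well. If [q] boards [c]
    directly, its next departure is at most [d], and each clause of domination makes [p] board
    directly or transfer before that departure. *)
Lemma dominates_extends T p q q' :
  dominates S p q -> extends S T q q' -> extends S T p q'.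
Proof.
move=> [le_pq pq] [c [d [[Sc Tc dc] [okq ->]]]].
exists c, d; split=> //; split=> //.
(* Time for a transfer suffices even when [p] boards [c] directly. *)
have tr : p.1 + transfer S <= d ->
    if boards p.2 c then p.1 <= d else p.1 + transfer S <= d.
  by case: ifP => // _; apply: leq_trans; rewrite leq_addr.
case bq: (boards q.2 c) okq => le_qd; last first.
  by apply: tr; apply: leq_trans le_qd; rewrite leq_add2r.
have [e ne le_ed] := ndep_exists Sc bq dc le_qd.
case: pq => [pq|ncq|[f [[[le_qf _] fmin] le_f]]].
- have -> : boards p.2 c by case: pq => ->.
  exact: leq_trans le_qd.
- apply: tr; apply: leq_trans le_ed.
  by apply: leq_trans (not_critical_ndep ncq ne); rewrite leq_add2r.
- apply: tr; have le_fe : f <= e by apply: fmin; case: ne.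
  apply: leq_trans le_ed; apply: leq_trans le_fe.
  by rewrite -leq_subRL //; apply: leq_trans le_qf.
Qed.

Lemma extends_leq T p q : extends S T p q -> p.1 <= q.1.
Proof.
case=> c [d [_ [ok ->]]] /=; apply: leq_trans (leq_addr _ _).
by case: ifP ok => // _; apply: leq_trans; rewrite leq_addr.
Qed.

Lemma extends_edge T p q : extends S T p q -> edge S T.
Proof.
case=> c [d [[Sc Tc /and3P[cc _ _]] _]].
by apply/existsP; exists c; rewrite cc Sc Tc !eqxx.
Qed.

(** A label keeps the arrival time and stop event of the last leg, which with the station [S] is all
    that [change_ok] asks of it; so any connection behind [p] can be prolonged. The wildcard starts
    a one-leg connection. *)
Lemma extends_arrival A t0 T p q :
  arrival_conn A t0 S p -> extends S T p q -> arrival_conn A t0 T q.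
Proof.
rewrite /arrival_conn; case: p => t [z|] /=; last first.
  move=> [-> ->] [c [d [[Sc Tc dc] [/= le_d ->]]]] /=.
  exists ((c, d, d + elength c), [::]).
  by rewrite /consistent /= /leg_ok /leg_conn /= dc eqxx.
move=> [[l s] [[cP fP dP] [toP arP stP]]] [c [d [[Sc Tc dc] [/= okc ->]]]] /=.
exists (l, rcons s (c, d, d + elength c)); split; split=> //; first last.
- by rewrite /stop_of /last_leg /= last_rcons.
- by rewrite /arr_of /last_leg /= last_rcons.
- by rewrite /to_of /last_leg /= last_rcons.
move: cP toP arP stP; rewrite /consistent /to_of /arr_of /stop_of /last_leg /=.
move=> /andP[/andP[-> okl] pl] toP arP stP.
rewrite all_rcons okl rcons_path pl /= andbT /leg_ok /= dc eqxx /=.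
by rewrite /change_ok /leg_conn /= Sc toP stP eqxx arP.
Qed.

End Domination.

Lemma min_arrP (tt : timetable) (N : {fset label tt}) q0 :
  q0 \in N ->
  (exists2 q, q \in N & q.1 = min_arr N) /\
  (forall q, q \in N -> min_arr N <= q.1).
Proof.
rewrite /min_arr => q0N; have: q0 \in enum_fset N by [].
have memN q : (q \in N) = (q \in enum_fset N) by [].
case: (enum_fset N) memN => // p s memN _.
have [ex lb] : (exists2 q, q \in p :: s &
                  q.1 = foldr minn p.1 [seq q.1 | q <- s]) /\
    forall q, q \in p :: s -> foldr minn p.1 [seq q.1 | q <- s] <= q.1.
  elim: s {memN} => [|a s [[q qin eqq] lb]] /=.
    split; first by exists p; rewrite ?inE.
    by move=> q; rewrite inE => /eqP->.
  split.
    case: (leqP a.1 (foldr minn p.1 [seq q.1 | q <- s])) => _.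
      by exists a; rewrite ?inE ?eqxx ?orbT.
    by exists q => //; move: qin; rewrite !inE => /orP[]->; rewrite ?orbT.
  move=> r; rewrite !inE orbCA => /orP[/eqP->|rin]; first exact: geq_minl.
  by apply: leq_trans (lb r _); rewrite ?inE ?geq_minr.
split; first by case: ex => q qin eqq; exists q; rewrite ?memN.
by move=> q; rewrite memN; apply: lb.
Qed.

(** * The loop invariant and its preservation *)

Section Algorithm.

Variables (tt : timetable) (A B : station tt) (t0 : nat).
Variable link : station tt * station tt -> {fset label tt} -> {fset label tt}.
Variable minimum :
  station tt -> {fset label tt} -> {fset label tt} -> {fset label tt}.
Hypotheses (hlink : link_spec A t0 link) (hminimum : minimum_spec A t0 minimum).

Implicit Types (st : state tt) (S T : station tt) (p q : label tt).
Implicit Types (ts : seq (station tt)).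

(** This replaces membership, which relaxation may destroy because [minimum] can drop labels. *)
Definition dominated st S q := exists2 p, p \in ac st S & dominates S p q.

Definition relaxed st S T :=
  forall p q, p \in ac st S -> extends S T p q -> dominated st T q.

Definition arrivals st :=
  forall S p, p \in ac st S -> arrival_conn A t0 S p.

(** This is the provenance under which [minimum_stable] applies. *)
Definition computed st S :=
  ac st S = initial_ac A t0 S \/
  exists Y Z, (forall q, q \in (Y `|` Z)%fset -> arrival_conn A t0 S q) /\
              ac st S = minimum S Y Z.

(* The edges from S to the stations of ts are still to be visited in the
   current iteration; ts is empty between two iterations. *)
Record invariant S ts st : Prop := Invariant {
  inv_arrivals : arrivals st;
  inv_computed : forall T, computed st T;
  inv_source : dominated st A (t0, None);
  inv_target : queue st B = None -> ac st B = fset0;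
  inv_key : forall T k, queue st T = Some k ->
    (exists2 q, q \in ac st T & q.1 = k) /\
    (forall q, q \in ac st T -> k <= q.1);
  inv_relaxed : forall S' T, queue st S' = None ->
    (S' = S -> T \notin ts) -> relaxed st S' T
}.

Lemma initial_invariant : invariant A [::] (initial_state A t0).
Proof.
have acA q : q \in initial_ac A t0 A -> q = (t0, None).
  by rewrite /initial_ac eqxx inE => /eqP.
have inA : (t0, None) \in initial_ac A t0 A.
  by rewrite /initial_ac eqxx inE eqxx.
split.
- move=> S p; rewrite /= ffunE /initial_ac; case: eqP => [->|_].
    by rewrite inE => /eqP->.
  by rewrite inE.
- by move=> T; left; rewrite /= ffunE.
- by exists (t0, None); [rewrite /= ffunE | apply: dominates_refl].
- by rewrite /= !ffunE /initial_ac; case: eqP.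
- move=> T k; rewrite /= !ffunE; case: eqP => // -> [<-].
  by split=> [|q /acA->//]; exists (t0, None).
- move=> S T; rewrite /= ffunE; case: eqP => // /eqP /negPf SA _ _ p q.
  by rewrite /= ffunE /initial_ac SA inE.
Qed.

Lemma dequeue_invariant S S' st :
  S <> B -> invariant S' [::] st ->
  invariant S (enum (edge S)) (dequeue st S).
Proof.
move=> SB [arr comp src tgt key rel]; split=> //.
(* The deleted station is never [B], so [B] stays queued once it has labels. *)
- rewrite /= ffunE; case: eqP => [BS|_]; last exact: tgt.
  by case: SB.
- by move=> T k; rewrite /= ffunE; case: eqP => // _; apply: key.
- move=> S'' T; rewrite /= ffunE; case: eqP => [->|_] qS nT.
    (* All edges out of [S] are pending, and to any other station no label of [S] extends. *)
    move=> p q pS /[dup] ext /extends_edge eST; have := nT erefl.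
    by rewrite mem_enum => /negP[].
  exact: rel.
Qed.

Lemma link_minimum S T st :
  arrivals st -> edge S T ->
  let L := link (S, T) (ac st S) in
  let N := minimum T (ac st T) L in
  [/\ forall q, q \in (ac st T `|` L)%fset -> arrival_conn A t0 T q,
      (N `<=` ac st T `|` L)%fset
    & forall q, q \in (ac st T `|` L)%fset ->
        exists2 p, p \in N & dominates T p q].
Proof.
move=> arr eST L N.
have arrU q : q \in (ac st T `|` L)%fset -> arrival_conn A t0 T q.
  rewrite inE => /orP[/arr//|qL].
  by have [/(_ q qL)[]] := hlink eST (@arr S).
by have [sub dom] := hminimum arrU.
Qed.

Lemma relax_dominated S T st S' q :
  arrivals st -> edge S T -> dominated st S' q ->
  dominated (relax link minimum S st T) S' q.
Proof.
move=> arr eST [p pS dom]; have [_ _ domN] := link_minimum arr eST.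
rewrite /relax; case: eqP => _; first by exists p.
rewrite /dominated /= ffunE; case: eqP => [eS|_]; last by exists p.
rewrite eS in pS dom *; have [|p' p'N dom'] := domN p.
  by rewrite inE pS.
by exists p' => //; apply: dominates_trans dom.
Qed.

(** If [ac st T] changes, [T] is queued again and its own edges are exempt from [inv_relaxed]. Other
    unqueued stations keep their labels, and what was dominated at their heads stays so; the edge
    just visited is settled by [extN]. *)
Lemma relax_invariant S T ts st :
  edge S T -> invariant S (T :: ts) st ->
  invariant S ts (relax link minimum S st T).
Proof.
move=> eST [arr comp src tgt key rel].
have keep S' q := @relax_dominated S T st S' q arr eST.
have [arrU subN domN] := link_minimum arr eST.
have extN p q : p \in ac st S -> extends S T p q ->
    exists2 p', p' \in minimum T (ac st T) (link (S, T) (ac st S))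
              & dominates T p' q.
  move=> pS ext.
  have [_ /(_ p q pS ext)] := hlink eST (@arr S).
  case=> [|q' q'L dom]; first exact: extends_arrival (arr _ _ pS) ext.
  have [|p' p'N dom'] := domN q'; first by rewrite inE q'L orbT.
  by exists p' => //; apply: dominates_trans dom.
move: keep; rewrite /relax; case: eqP => [eqN|neqN] keep.
  split=> // S' T' qS' nT'.
  case: (eqVneq T' T) => [->|neT]; last first.
    by apply: rel => // /nT' nin; rewrite inE negb_or neT.
  case: (eqVneq S' S) => [->|neS].
    by move=> p q pS ext; have := extN p q pS ext; rewrite eqN.
  by apply: rel => // eS; rewrite eS eqxx in neS.
set N := minimum _ _ _ in subN domN extN neqN keep *.
split=> //=.
- move=> S' p; rewrite /= ffunE; case: eqP => [->|_]; last exact: arr.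
  by move=> pN; apply: arrU; apply: (fsubsetP subN).
- move=> T'; rewrite /computed /= ffunE; case: eqP => [->|_]; last exact: comp.
  by right; exists (ac st T), (link (S, T) (ac st S)).
- exact: keep.
- by rewrite !ffunE; case: eqP.
- move=> T' k; rewrite !ffunE; case: eqP => [_ [<-]|_]; last exact: key.
  (* An empty union would make [N] and [ac st T] both empty, against [neqN]; so [min_arr] does not
     fall back on 0. *)
  case: (fset_0Vmem (ac st T `|` link (S, T) (ac st S))%fset) => [U0|[q /domN]].
    case: neqN; move: subN; rewrite U0 fsubset0 => /eqP->.
    by apply/esym/eqP; rewrite -fsubset0 -U0 fsubsetUl.
  by move=> [p pN _]; apply: min_arrP pN.
- move=> S' T'; rewrite ffunE; case: eqP => // /eqP/negPf neS' qS' nT' p q.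
  rewrite /= ffunE neS' => pS' ext.
  case: (eqVneq T' T) => [eT|neT]; last first.
    apply/keep/(rel S' T' qS' _ p) => // /nT' nin.
    by rewrite inE negb_or neT.
  rewrite eT in ext *.
  case: (eqVneq S' S) => [eS|neS].
    rewrite eS in pS' ext; rewrite /dominated /= ffunE eqxx.
    exact: (extN p).
  by apply/keep/(rel S' T qS' _ p) => // eS; rewrite eS eqxx in neS.
Qed.

Lemma relaxes_invariant S ts st :
  (forall T, T \in ts -> edge S T) -> invariant S ts st ->
  invariant S [::] (foldl (relax link minimum S) st ts).
Proof.
elim: ts st => //= T ts IH st eS inv; apply: IH.
  by move=> T' T'ts; apply: eS; rewrite inE T'ts orbT.
by apply: relax_invariant inv; apply: eS; rewrite mem_head.
Qed.

Lemma invariant_perm S ts ts' st :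
  perm_eq ts ts' -> invariant S ts' st -> invariant S ts st.
Proof.
move=> pts [arr comp src tgt key rel]; split=> // S' T qS' nT.
by apply: rel => // /nT; rewrite (perm_mem pts).
Qed.

Lemma iteration_invariant S st st' :
  invariant S [::] st -> iteration link minimum B st st' ->
  exists S', invariant S' [::] st'.
Proof.
move=> inv [S' [t [ts [_ SB pts ->]]]]; exists S'.
apply: relaxes_invariant.
  by move=> T; rewrite (perm_mem pts) mem_enum.
exact/(invariant_perm pts)/(dequeue_invariant SB inv).
Qed.

(** * Correctness of the returned value *)

(* The Dijkstra argument: a queued station has no label earlier than its key,
   so all stations visited before the least key are fully relaxed. *)
Lemma extends_dominated R st S T p q t :
  invariant R [::] st -> (forall S' k, queue st S' = Some k -> t < k) ->
  dominated st S p -> extends S T p q -> q.1 <= t -> dominated st T q.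
Proof.
move=> inv late [p' p'S dom] ext le_qt.
have qS : queue st S = None.
  case qS: (queue st S) => [k|] //.
  have [_ /(_ _ p'S) le_kp'] := inv_key inv qS.
  have := late _ _ qS; rewrite ltnNge => /negP[].
  apply: leq_trans le_kp' (leq_trans (dominates_leq dom) _).
  exact: leq_trans (extends_leq ext) le_qt.
exact: (inv_relaxed inv qS _ p'S (dominates_extends dom ext)).
Qed.

Lemma leg_extends (l : leg tt) S p :
  leg_ok l -> S1 (leg_conn l) = S ->
  (if boards p.2 (leg_conn l) then p.1 <= leg_dep l
   else p.1 + transfer S <= leg_dep l) ->
  extends S (S2 (leg_conn l)) p (leg_arr l, Some (Z2 (leg_conn l))).
Proof.
move=> /andP[dl /eqP arrl] Sl okl.
by exists (leg_conn l), (leg_dep l); rewrite arrl.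
Qed.

(** Induction on prefixes, starting from the wildcard at [A]. Arrival times never decrease along
    extensions, so every prefix also arrives by [t]. *)
Lemma connection_dominated R st (P : connection tt) t :
  invariant R [::] st -> (forall S k, queue st S = Some k -> t < k) ->
  consistent P -> from_of P = A -> t0 <= dep_of P -> arr_of P <= t ->
  dominated st (to_of P) (arr_of P, Some (stop_of P)).
Proof.
move=> inv late; case: P => l s.
rewrite /consistent /from_of /dep_of /arr_of /to_of /stop_of /last_leg /=.
move=> /andP[/andP[okl oks] pls] lA le_t0.
elim/last_ind: s oks pls => [_ _|s l' IH] /=.
  move=> le_t; have := inv_source inv.
  move=> /(extends_dominated inv late); apply=> //; exact: leg_extends.
rewrite all_rcons rcons_path last_rcons => /andP[okl' oks] /andP[ps chg] le_t.
case/andP: chg; move: (last l s) (IH oks ps) => m {}IH /eqP Sm chg.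
have ext : extends (S2 (leg_conn m)) (S2 (leg_conn l'))
    (leg_arr m, Some (Z2 (leg_conn m))) (leg_arr l', Some (Z2 (leg_conn l'))).
  exact: leg_extends.
apply: (extends_dominated inv late _ ext le_t); apply: IH.
exact: leq_trans (extends_leq ext) le_t.
Qed.

Lemma journey_dominated R st t t' :
  invariant R [::] st -> (forall S k, queue st S = Some k -> t < k) ->
  journey_arrival A B t0 t' -> t' <= t ->
  exists2 q, q \in ac st B & q.1 <= t'.
Proof.
move=> inv late [[<- ->]|[P [cP fP <- dP <-]]] le_t't.
  by have [q qA /dominates_leq] := inv_source inv; exists q.
have [q qP /dominates_leq] := connection_dominated inv late cP fP dP le_t't.
by exists q.
Qed.

Lemma arrival_journey q :
  arrival_conn A t0 B q -> journey_arrival A B t0 q.1.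
Proof.
rewrite /arrival_conn; case: q.2 => [z|]; last by case=> ->; left.
by case=> P [[cP fP dP] [toP arP _]]; right; exists P.
Qed.

(** In both stopping cases the arrival time [t'] of a supposed better journey lies below all keys,
    so [B] holds a label that is at least as early: impossible if [ac st B] is empty or has least
    arrival time [t]. *)
Lemma returns_correct R st r :
  returns link minimum B st r -> invariant R [::] st ->
  earliest_arrival A B t0 r.
Proof.
move=> ret; elim: ret R => {st r} [st q0|st t [qB tmin]|st st' r it _ IH] R inv.
- move=> t' jt'.
  have late S k : queue st S = Some k -> t' < k by rewrite q0.
  have [q qB _] := journey_dominated inv late jt' (leqnn t').
  by rewrite (inv_target inv (q0 B)) inE in qB.
- have [[q qac eq_t] lb] := inv_key inv qB; split.
    by rewrite -eq_t; apply/arrival_journey/(inv_arrivals inv).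
  move=> t' jt'; rewrite leqNgt; apply/negP => lt_t'.
  have late S k : queue st S = Some k -> t' < k.
    by move=> /tmin; apply: leq_trans.
  have [q' q'B le_q'] := journey_dominated inv late jt' (leqnn t').
  by have := leq_trans (lb _ q'B) le_q'; rewrite leqNgt lt_t'.
- by have [R' inv'] := iteration_invariant inv it; apply: IH inv'.
Qed.

Lemma delete_min_exists st :
  (forall S, queue st S = None) \/ exists S t, is_delete_min st S t.
Proof.
have [/existsP[S qS]|/existsPn noq] := boolP [exists S, queue st S != None].
  right; have := @arg_minnP _ S (fun S => queue st S != None)
    (fun S => odflt 0 (queue st S)) qS.
  case=> R qR Rmin.
  exists R, (odflt 0 (queue st R)); split; first by case: (queue st R) qR.
  by move=> T t qT; have := Rmin T; rewrite qT; apply.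
by left=> S; have := noq S; rewrite negbK => /eqP.
Qed.

(** No state is stuck: the queue is empty, or a least key exists and its station is [B] or can be
    expanded. *)
Lemma terminates_returns st :
  terminates link minimum B st -> exists r, returns link minimum B st r.
Proof.
elim=> {}st _ IH; case: (delete_min_exists st) => [q0|[S [t Smin]]].
  by exists None; apply: Returns_bottom.
have [SB|/eqP SB] := eqVneq S B.
  by exists (Some t); apply: Returns_target; rewrite -SB.
pose st' := foldl (relax link minimum S) (dequeue st S) (enum (edge S)).
have it : iteration link minimum B st st' by exists S, t, (enum (edge S)).
by have [r ret] := IH _ it; exists r; apply: Returns_iteration it ret.
Qed.

(** * Termination by a lexicographic rank *)

Section Termination.

Hypothesis stable : minimum_stable A t0 minimum.

(** The label tested need not represent a connection, which makes the covered times of [u] an upper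
    set. *)
Definition covered st (u : station tt * stop tt) n :=
  dominated st u.1 (n, Some u.2).

Definition progress st st' :=
  (forall u n, covered st u n -> covered st' u n) /\
  exists u n, covered st' u n /\ ~ covered st u n.

Lemma covered_leq st u n m : covered st u n -> n <= m -> covered st u m.
Proof.
move=> [p pS dom] le_nm; exists p => //; apply: dominates_trans dom _.
by split=> //; apply: Or31; right.
Qed.

(** If every linked label is already dominated, stability keeps [ac st T]; otherwise an undominated
    one becomes newly covered. *)
Lemma relax_progress S T ts st :
  edge S T -> invariant S ts st ->
  relax link minimum S st T = st \/ progress st (relax link minimum S st T).
Proof.
move=> eST inv; have arr := inv_arrivals inv.
have [arrU _ domN] := link_minimum arr eST.
have [covL|ncovL] :=
    classic (forall q, q \in link (S, T) (ac st S) -> dominated st T q).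
  by left; rewrite /relax (stable arrU (inv_computed inv T)) ?eqxx.
right; split=> [u n|]; first exact: relax_dominated.
have [q nq] := not_all_ex_not _ _ ncovL.
have [qL ndom] := imply_to_and _ _ nq.
(* A linked label ends with an elementary connection, so it is not the wildcard and has the form
   that [covered] tests. *)
have [/(_ q qL)[_ [p _ [c [d [_ [_ eq_q]]]]]] _] := hlink eST (@arr S).
exists (T, Z2 c), q.1; rewrite /covered /=.
have -> : (q.1, Some (Z2 c)) = q by rewrite eq_q.
split=> //; have [|p' p'N dom] := domN q; first by rewrite inE qL orbT.
rewrite /relax; case: eqP => [eqN|_].
  by case: ndom; exists p'; rewrite // -eqN.
by exists p'; rewrite //= ffunE eqxx.
Qed.

Lemma relaxes_progress S ts st :
  (forall T, T \in ts -> edge S T) -> invariant S ts st ->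
  foldl (relax link minimum S) st ts = st \/
  progress st (foldl (relax link minimum S) st ts).
Proof.
elim: ts st => [|T ts IH] st eS inv /=; first by left.
have eST : edge S T by apply: eS; rewrite mem_head.
have eS' T' : T' \in ts -> edge S T'.
  by move=> T'ts; apply: eS; rewrite inE T'ts orbT.
have := IH _ eS' (relax_invariant eST inv).
case: (relax_progress eST inv) => [-> //|prog].
case=> [->|[sub _]]; right=> //.
have [sub' [u [n [cov ncov]]]] := prog.
split=> [v m /sub'/sub//|]; exists u, n; split=> //; exact: sub.
Qed.

(** A relation, because [covered] is only a proposition and its minima cannot be computed. *)
Definition earliest st (b : {ffun station tt * stop tt -> option nat}) :=
  forall u, if b u is Some n then
              covered st u n /\ forall m, covered st u m -> n <= m
            else forall m, ~ covered st u m.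

Lemma earliest_exists st : exists b, earliest st b.
Proof.
have /fin_all_exists[f fP] : forall u, exists o : option nat,
    if o is Some n then covered st u n /\ forall m, covered st u m -> n <= m
    else forall m, ~ covered st u m.
  move=> u; have [[n /ex_least[m [cov _ mmin]]]|none] :=
    classic (exists n, covered st u n).
    by exists (Some m).
  by exists None => m cov; apply: none; exists m.
by exists (finfun f) => u; rewrite ffunE; apply: fP.
Qed.

Definition uncovered (b : {ffun station tt * stop tt -> option nat}) :=
  #|[set u | b u == None]|.
Definition total (b : {ffun station tt * stop tt -> option nat}) :=
  \sum_u odflt 0 (b u).

Lemma progress_rank st st' b b' :
  earliest st b -> earliest st' b' -> progress st st' ->
  uncovered b' < uncovered b \/
  uncovered b' = uncovered b /\ total b' < total b.
Proof.
move=> eb eb' [sub [u [n [cov ncov]]]].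
have le_b v k : b v = Some k -> exists2 m, b' v = Some m & m <= k.
  move=> bv; have := eb v; rewrite bv => -[/sub cov' _].
  have := eb' v; case: (b' v) => [m [_ mmin]|/(_ k)[]//].
  by exists m => //; apply: mmin.
have sub0 : [set v | b' v == None] \subset [set v | b v == None].
  apply/subsetP => v; rewrite !inE; case bv: (b v) => [k|] //.
  by have [m ->] := le_b _ _ bv.
have := subset_leqif_cards sub0; rewrite /uncovered.
case=> le_card eq_card.
case: ltngtP le_card => // [lt_card|eq0] _; first by left.
(* Inclusion with equal cardinality makes the empty upper sets the same ones, so the default 0 in
   [total] occurs at the same places on both sides. *)
right; split=> //; move/eqP: eq0; rewrite eq_card => /eqP /setP eq0.
have := eb u; have := eq0 u; rewrite !inE.
have := eb' u; case b'u: (b' u) => [m|]; last by move=> /(_ n)[].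
move=> [_ mmin].
case bu: (b u) => [k|//] _ [covk _].
rewrite /total (bigD1 u) //= [X in _ < X](bigD1 u) //= b'u bu /=.
rewrite -addSn leq_add //.
  (* If the old minimum [k] were at most [m], hence at most [n], then [n] would have been covered
     before. *)
  rewrite ltnNge; apply/negP => le_km; apply: ncov.
  exact: covered_leq covk (leq_trans le_km (mmin _ cov)).
apply: leq_sum => v _; case bv: (b v) => [l|].
  by have [i -> le_il] := le_b _ _ bv.
by have := eq0 v; rewrite !inE bv eqxx => /eqP->.
Qed.

Definition queued st := #|[set S | queue st S != None]|.

Lemma dequeue_queued S t st :
  queue st S = Some t -> queued (dequeue st S) < queued st.
Proof.
move=> qS; apply: proper_card; apply/properP; split.
  by apply/subsetP => T; rewrite !inE ffunE; case: ifP.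
by exists S; rewrite !inE ?ffunE ?eqxx ?qS.
Qed.

Lemma invariant_terminates R st :
  invariant R [::] st -> terminates link minimum B st.
Proof.
have [b] := earliest_exists st.
move: {2}(uncovered b) {2}(total b) {2}(queued st) (erefl (uncovered b))
  (erefl (total b)) (erefl (queued st)) => n1 n2 n3.
elim/ltn_ind: n1 n2 n3 R st b => n1 IH1.
elim/ltn_ind => n2 IH2; elim/ltn_ind => n3 IH3 R st b eq1 eq2 eq3 eb inv.
constructor=> st' it; have [R' inv'] := iteration_invariant inv it.
have [S [t [ts [[qS _] SB pts def_st']]]] := it.
have eS T : T \in ts -> edge S T by rewrite (perm_mem pts) mem_enum.
have invd := invariant_perm pts (dequeue_invariant SB inv).
have := relaxes_progress eS invd; rewrite -def_st' => -[eq_st'|prog].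
  (* No label set changed, so the same [b] serves and only the queue has shrunk. *)
  rewrite eq_st' in inv' *.
  apply: (IH3 _ _ R' _ b _ _ erefl) inv' => //.
  by rewrite -eq3; apply: dequeue_queued qS.
have [b' eb'] := earliest_exists st'.
have [|[]] := progress_rank eb eb' prog; rewrite eq1 ?eq2.
  by move=> lt1; apply: (IH1 _ lt1 _ _ R' st' b').
by move=> eq1' lt2; apply: (IH2 _ lt2 _ R' st' b').
Qed.

End Termination.

End Algorithm.

Theorem theorem1 (tt : timetable) (A B : station tt) (t0 : nat)
    (link : station tt * station tt -> {fset label tt} -> {fset label tt})
    (minimum : station tt -> {fset label tt} -> {fset label tt} ->
               {fset label tt})
    (hlink : link_spec A t0 link)
    (hminimum : minimum_spec A t0 minimum) :
  (forall r : option nat,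
     returns link minimum B (initial_state A t0) r ->
     earliest_arrival A B t0 r) /\
  (terminates link minimum B (initial_state A t0) ->
     exists r : option nat, returns link minimum B (initial_state A t0) r) /\
  (minimum_stable A t0 minimum ->
     terminates link minimum B (initial_state A t0)).

Proof.
have inv0 := initial_invariant A B t0 minimum.
split; first by move=> r ret; apply: returns_correct ret inv0.
split; first exact: terminates_returns.
by move=> stable; apply: invariant_terminates inv0.
Qed.
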